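(* Let $n\ge 1$ be an integer. For every nonempty set $E\subseteq\mathbb R^n$, \[ \dim_H(E)=\min_{\varphi}\ \sup_{x\in E}\ \liminf_{r\to\infty}\frac{K_\varphi(x;r)}{r}, \qquad \dim_P(E)=\min_{\varphi}\ \sup_{x\in E}\ \limsup_{r\to\infty}\frac{K_\varphi(x;r)}{r}, \] where $\varphi$ ranges over all prefix-free ball codes in $\mathbb R^n$. In both cases the minimum is attained by some prefix-free ball code.
   Context: Let $2^{<\omega}$ be the set of finite binary strings and $|p|$ the length of $p$; $\omega=\{0,1,2,\dots\}$. A set $D\subseteq 2^{<\omega}$ is prefix-free if no element of $D$ is a proper prefix of another element of $D$. A prefix-free ball code in $\mathbb R^n$ is a map $\varphi:D\to\mathcal B$, where $D=\operatorname{dom}(\varphi)\subseteq 2^{<\omega}$ is prefix-free and $\mathcal B$ is the collection of all closed Euclidean balls of positive radius in $\mathbb R^n$ (no injectivity, surjectivity or computability is required). For $x\in\mathbb R^n$ and $r\in\omega$, \[ K_\varphi(x;r)=\min\{|p|: p\in\operatorname{dom}(\varphi),\ x\in\varphi(p),\ \operatorname{diam}\varphi(p)\le 2^{-r}\}, \] with $K_\varphi(x;r)=\infty$ if no such $p$ exists. Hausdorff dimension: $\mathcal H^s_\delta(E)$ is the infimum of $\sum_i(\operatorname{diam}U_i)^s$ over finite or countable covers $(U_i)$ of $E$ with $0<\operatorname{diam}U_i\le\delta$; $\mathcal H^s(E)=\lim_{\delta\to0}\mathcal H^s_\delta(E)$; $\dim_H(E)=\inf\{s\ge0:\mathcal H^s(E)=0\}$.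 Packing dimension: a $\delta$-packing of $E$ is a finite or countable, possibly empty, family of pairwise disjoint closed balls of positive radius at most $\delta$ with centers in $E$; $\mathcal P^s_\delta(E)$ is the supremum of $\sum_i(\operatorname{diam}B_i)^s$ over $\delta$-packings $(B_i)$ of $E$; $\mathcal P^s_0(E)=\lim_{\delta\to0}\mathcal P^s_\delta(E)$; $\mathcal P^s(E)=\inf\{\sum_{j\ge1}\mathcal P^s_0(E_j):E\subseteq\bigcup_{j\ge1}E_j\}$; $\dim_P(E)=\inf\{s\ge0:\mathcal P^s(E)=0\}$. *)

(* Defs.v *)
From mathcomp Require Import all_boot all_order all_algebra.
From mathcomp Require Import all_classical all_reals all_analysis.

Set Implicit Arguments.
Unset Strict Implicit.
Unset Printing Implicit Defensive.

Import Order.TTheory GRing.Theory Num.Theory.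
Import numFieldNormedType.Exports.

Local Open Scope classical_set_scope.
Local Open Scope ring_scope.
Local Open Scope ereal_scope.

Section Euclidean.
Context {R : realType} {n : nat}.
Implicit Types (x y c : 'rV[R]_n) (U E : set 'rV[R]_n).

(* The norm that the library puts on row vectors is the sup norm, hence an
   explicit Euclidean distance. *)
Definition edist x y : R :=
  Num.sqrt (\sum_(i < n) (x ord0 i - y ord0 i) ^+ 2)%R.

Definition eball c (r : R) : set 'rV[R]_n := [set x | (edist c x <= r)%R].

Definition is_eball U : Prop := exists c r, (0 < r)%R /\ U = eball c r.

(* Equal to -oo on the empty set, so that 0 < diam U forces U to be nonempty. *)
Definition diam U : \bar R :=
  ereal_sup [set (edist xy.1 xy.2)%:E | xy in U `*` U].

End Euclidean.

Definition prefix_free (D : set (seq bool)) : Prop :=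
  forall p q, D p -> D q -> prefix p q -> p = q.

(* The values of [code_ball] outside [code_dom] are never used. *)
Record ball_code (R : realType) (n : nat) := BallCode {
  code_dom : set (seq bool);
  code_ball : seq bool -> set 'rV[R]_n;
  code_prefix_free : prefix_free code_dom;
  code_is_ball : forall p, code_dom p -> is_eball (code_ball p) }.

Section Complexity.
Context {R : realType} {n : nat}.
Implicit Types (phi : ball_code R n) (x : 'rV[R]_n) (r : nat).

(* The infimum is over a set of natural numbers: it is +oo if the set is empty
   and a minimum otherwise. *)
Definition K phi x r : \bar R :=
  ereal_inf [set (size p)%:R%:E | p in
    [set p | [/\ code_dom phi p, code_ball phi p x
               & diam (code_ball phi p) <= (2 ^- r)%:E]]].

(* The value of the quotient at r = 0 does not affect the limits. *)
Definition K_liminf phi x : \bar R :=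
  limn_einf (fun r : nat => K phi x r / r%:R%:E).

Definition K_limsup phi x : \bar R :=
  limn_esup (fun r : nat => K phi x r / r%:R%:E).

End Complexity.

(* Finite or countable families are indexed by an arbitrary I : set nat. *)
Section Dimensions.
Context {R : realType} {n : nat}.
Implicit Types (E : set 'rV[R]_n) (s delta : R).

Definition is_cover delta E (I : set nat) (U : nat -> set 'rV[R]_n) : Prop :=
  E `<=` \bigcup_(i in I) U i /\
  forall i, I i -> 0 < diam (U i) /\ diam (U i) <= delta%:E.

Definition hausdorff_delta s delta E : \bar R :=
  ereal_inf [set t | exists I U, is_cover delta E I U /\
                                 t = \esum_(i in I) (diam (U i) `^ s)].

Definition hausdorff_measure s E : \bar R :=
  lim (hausdorff_delta s delta E @[delta --> 0%R^'+]).

Definition hausdorff_dim E : \bar R :=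
  ereal_inf [set s%:E | s in
    [set s : R | (0 <= s)%R /\ hausdorff_measure s E = 0]].

Definition is_packing delta E (I : set nat)
    (c : nat -> 'rV[R]_n) (r : nat -> R) : Prop :=
  (forall i, I i -> [/\ E (c i), (0 < r i)%R & (r i <= delta)%R]) /\
  trivIset I (fun i => eball (c i) (r i)).

Definition packing_delta s delta E : \bar R :=
  ereal_sup [set t | exists I c r, is_packing delta E I c r /\
               t = \esum_(i in I) (diam (eball (c i) (r i)) `^ s)].

Definition packing_premeasure s E : \bar R :=
  lim (packing_delta s delta E @[delta --> 0%R^'+]).

Definition packing_measure s E : \bar R :=
  ereal_inf [set \sum_(j <oo) packing_premeasure s (F j) | F in
    [set F : nat -> set 'rV[R]_n | E `<=` \bigcup_j F j]].

Definition packing_dim E : \bar R :=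
  ereal_inf [set s%:E | s in
    [set s : R | (0 <= s)%R /\ packing_measure s E = 0]].

End Dimensions.

Definition is_minimum {R : realType} (A : set (\bar R)) (m : \bar R) : Prop :=
  A m /\ lbound A m.

(* Main.v *)
(* Kraft's inequality makes 2^-|p| a summable weight on the code words, and
   conversely every summable family of weights 2^-l comes from a prefix-free
   code with word lengths l + O(1).

   Lower bounds. If K(x;r) < t r for infinitely many r, the code balls of
   diameter at most 2^-r with |p| < t r cover, and for s > t
   diam^s <= 2^-rs <= 2^-r(s-t) 2^-|p|, which sums to at most 2^-r(s-t). If it
   holds for all r >= m, a ball of radius about 2^-r of a packing contains the
   code ball of its center, so that disjoint balls have distinct words.

   Attainment. For the Hausdorff dimension, encode the sets U of finer and finer
   covers with lengths about -s log2 (diam U). For the packing dimension, encode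
   at each scale 2^-r a maximal packing, which has at most 2^(r+1)s balls, with
   lengths about r(s+e). Countably many codes phi_k are merged by the tags 1^k 0,
   at a cost of k+1 bits that vanishes in the limit; this lets s tend to the
   dimension and glues the pieces of the countable decompositions in the
   definition of the packing measure. *)

Require Import Defs.
From mathcomp Require Import all_boot all_order all_algebra.
From mathcomp Require Import all_classical all_reals all_analysis.
From mathcomp Require Import ring lra.

(* Again, since mathcomp-analysis has its own [edist]. *)
Import Defs.

Set Implicit Arguments.
Unset Strict Implicit.
Unset Printing Implicit Defensive.

Import Order.TTheory GRing.Theory Num.Theory.
Import numFieldNormedType.Exports.

Local Open Scope classical_set_scope.
Local Open Scope ring_scope.

(** * Kraft's inequality and its converse *)

Definition prefix_free_on (T : Type) (I : set T) (w : T -> seq bool) :=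
  forall t u, I t -> I u -> prefix (w t) (w u) -> t = u.

Section Kraft.
Context {R : realType}.

(** Induction on a bound for the word lengths. An empty word can only occur alone; otherwise split
    by first letter, and deleting that letter doubles every weight, so each half contributes at most
    1/2. *)
Lemma kraft_seq (T : eqType) (w : T -> seq bool) (s : seq T) : uniq s ->
  prefix_free_on [set` s] w -> \sum_(t <- s) 2 ^- size (w t) <= 1 :> R.
Proof.
have [L] : exists L, forall t, t \in s -> (size (w t) <= L)%N.
  exists (\max_(t <- s) size (w t)) => t ts.
  by rewrite (big_rem t) //= leq_maxl.
elim: L w s => [|L IH] w s sL us pf.
  have w0 t : t \in s -> w t = [::] by move=> /sL; case: (w t).
  case: s us pf w0 {sL} => [|a [|b s]] us pf w0.
  - by rewrite big_nil.
  - by rewrite big_seq1 w0 ?mem_head // expr0 invr1.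
  - have ab : a = b.
      by apply: pf; rewrite /= ?w0 ?inE ?eqxx ?orbT.
    by move: us; rewrite ab /= mem_head.
have [/hasP[a sa /eqP wa]|/hasPn nil] := boolP (has (fun t => w t == [::]) s).
  have -> : s = [:: a].
    apply: perm_small_eq => //; apply: uniq_perm => // t.
    rewrite inE; apply/idP/eqP => [st|->//].
    by apply/esym; apply: pf => //=; rewrite wa prefix0s.
  by rewrite big_seq1 wa expr0 invr1.
pose h b := [seq t <- s | head false (w t) == b].
have hb b : \sum_(t <- s | head false (w t) == b) 2 ^- size (w t) <= 2^-1 :> R.
  rewrite -big_filter -[leRHS]mulr1.
  have -> : \sum_(t <- h b) 2 ^- size (w t) =
      2^-1 * \sum_(t <- h b) 2 ^- size (behead (w t)) :> R.
    rewrite mulr_sumr; apply: eq_big_seq => t; rewrite mem_filter => /andP[_ /nil].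
    by case: (w t) => //= x v _; rewrite exprS invfM.
  rewrite ler_pM2l ?invr_gt0 //; apply: (IH (fun t => behead (w t)) (h b)).
  - move=> t; rewrite mem_filter => /andP[_ st]; move: (sL _ st).
    by rewrite size_behead; case: (size _).
  - exact: filter_uniq.
  - move=> t u /=; rewrite !mem_filter => /andP[/eqP ht st] /andP[/eqP hu su] p.
    apply: pf => //; have := nil _ st; have := nil _ su; move: p ht hu.
    by case: (w t) (w u) => [|x v] [|y v'] //= ? -> ->; rewrite eqxx.
rewrite (bigID (fun t => head false (w t) == true)) /=.
have half : 2^-1 + 2^-1 = 1 :> R by lra.
rewrite -[leRHS]half; apply: lerD => //.
by rewrite (eq_bigl (fun t => head false (w t) == false)) // => t; case: head.
Qed.

Lemma kraft (T : choiceType) (I : set T) (w : T -> seq bool) :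
  prefix_free_on I w -> (\esum_(t in I) (2 ^- size (w t))%:E <= 1%:E :> \bar R)%E.
Proof.
move=> pf; apply: ge_ereal_sup => _ [X [finX XI] <-].
rewrite fsbig_finite //= sumEFin lee_fin; apply: kraft_seq => //.
move=> t u /=; rewrite !in_fset_set // !inE => /XI It /XI Iu.
exact: pf.
Qed.

Fixpoint bits (L : nat) (x : R) : seq bool :=
  if L is L'.+1 then (2^-1 <= x) :: bits L' (x * 2 - (2^-1 <= x)%R%:R) else [::].

Lemma size_bits L x : size (bits L x) = L.
Proof. by elim: L x => //= L IH x; rewrite IH. Qed.

(** [bits] lists leading binary digits, so the two numbers lie in the same half-open dyadic interval
    of length 2^-L. *)
Lemma bits_prefix L M (x y : R) : 0 <= x < 1 -> 0 <= y < 1 ->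
  prefix (bits L x) (bits M y) -> `|x - y| < 2 ^- L.
Proof.
elim: L M x y => [|L IH] [|M] x y /andP[x0 x1] /andP[y0 y1] //=.
- by rewrite expr0 invr1 => _; rewrite ltr_norml; lra.
- by rewrite expr0 invr1 => _; rewrite ltr_norml; lra.
have step (z : R) : 0 <= z -> z < 1 -> 0 <= z * 2 - (2^-1 <= z)%R%:R < 1.
  by move=> z0 z1; case: (lerP 2^-1 z) => /= hz; lra.
case/andP=> /eqP xy /IH => /(_ (step _ x0 x1) (step _ y0 y1)).
rewrite xy exprS invfM => H.
have -> : x - y = 2^-1 * (x * 2 - (2^-1 <= y)%R%:R - (y * 2 - (2^-1 <= y)%R%:R)).
  by lra.
by rewrite normrM gtr0_norm // ltr_pM2l.
Qed.

(* Shannon-Fano-Elias coding: the weights 2^-l(t) are laid out as disjoint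
   intervals, and t is encoded by the leading bits of the midpoint of its
   interval. *)
Lemma kraft_converse (T : countType) (I : set T) (l : T -> nat) (M : R) :
  (\esum_(t in I) (2 ^- l t)%:E <= M%:E)%E ->
  exists (w : T -> seq bool) (C : nat),
    prefix_free_on I w /\ forall t, size (w t) = (l t + C)%N.
Proof.
move=> sumM.
(* The total weight may exceed 1; the whole layout is shrunk by 2^C to fit into [0, 1[, at a cost of
   C bits per word. *)
have [C MC] : exists C : nat, M <= 2 ^+ C.
  exists (Num.truncn M).+1; apply: ltW; apply: (lt_le_trans (truncnS_gt M)).
  by rewrite -natrX ler_nat ltnW // ltn_expl.
pose A (t : T) := I `&` [set u | (pickle u < pickle t)%N].
have wt0 (t : T) : (0 <= (2 ^- l t)%:E :> \bar R)%E.
  by rewrite lee_fin invr_ge0 exprn_ge0.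
have sub (X Y : set T) : X `<=` Y ->
    (\esum_(t in X) (2 ^- l t)%:E <= \esum_(t in Y) (2 ^- l t)%:E :> \bar R)%E.
  by move=> XY; apply: ge_ereal_sup => _ [Z [fZ ZX] <-]; apply: esum_ge; exists Z;
    first (split => //; exact: subset_trans XY).
have step t (B : set T) : I t -> A t `<=` B -> B t ->
    (\esum_(u in A t) (2 ^- l u)%:E + (2 ^- l t)%:E <=
      \esum_(u in B) (2 ^- l u)%:E :> \bar R)%E.
  move=> It AB Bt; rewrite [leRHS](esumID (A t)) // leeD //.
    by apply: sub => u Au; split => //; exact: AB.
  rewrite -(@esum_set1 R T t (fun u => (2 ^- l u)%:E)) //.
  by apply: sub => u ->; split => //= -[_ /=]; rewrite ltnn.
(* Left end of the interval of t before shrinking: the weights of all indices that precede t in the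
   enumeration by [pickle]. *)
pose F t := fine (\esum_(u in A t) (2 ^- l u)%:E : \bar R).
have FE t : (\esum_(u in A t) (2 ^- l u)%:E = (F t)%:E :> \bar R)%E.
  rewrite fineK // ge0_fin_numE ?esum_ge0 //.
  by apply: (le_lt_trans _ (ltry M)); apply: le_trans sumM; apply: sub => u [].
have F0 t : 0 <= F t by rewrite -lee_fin -FE esum_ge0.
have FM t : I t -> F t + 2 ^- l t <= 2 ^+ C.
  move=> It; rewrite -lee_fin EFinD -FE; apply: le_trans (_ : (M%:E <= _)%E) => //.
  by apply: le_trans sumM; apply: step => // u [].
have Fmono t u : I t -> I u -> (pickle t < pickle u)%N -> F t + 2 ^- l t <= F u.
  move=> It Iu tu; rewrite -lee_fin EFinD -!FE; apply: step => //.
  by move=> v [Iv /= vt]; split => //=; exact: ltn_trans tu.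
pose x t := (F t + 2 ^- (l t).+1) / 2 ^+ C.
have half t : 2 ^- l t = 2 ^- (l t).+1 + 2 ^- (l t).+1 :> R.
  by rewrite exprS invfM; set z : R := _^-1; lra.
have p0 k : 0 < 2 ^- k :> R by rewrite invr_gt0 exprn_gt0.
have x01 t : I t -> 0 <= x t < 1.
  move=> It; rewrite divr_ge0 ?addr_ge0 ?exprn_ge0 ?invr_ge0 //=.
  rewrite ltr_pdivrMr ?exprn_gt0 // mul1r.
  have := FM t It; rewrite half; have := p0 (l t).+1; lra.
(* With one bit more than the shrunken interval of t requires, a common prefix puts the midpoints
   closer than half its width, while midpoints of disjoint intervals are at least half the sum of
   both widths apart. *)
exists (fun t => bits (l t + C.+1) (x t)), C.+1; split; last first.
  by move=> t; rewrite size_bits.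
move=> t u It Iu /(bits_prefix (x01 _ It) (x01 _ Iu)).
have -> : 2 ^- (l t + C.+1) = 2 ^- (l t).+1 / 2 ^+ C :> R.
  by rewrite addnS -addSn exprD invfM.
rewrite -mulrBl normrM [X in _ * X]ger0_norm ?invr_ge0 ?exprn_ge0 //.
rewrite ltr_pM2r ?invr_gt0 ?exprn_gt0 // => H.
have pt := p0 (l t).+1; have pu := p0 (l u).+1.
case: (ltngtP (pickle t) (pickle u)) => [tu|ut|/(pcan_inj pickleK) //].
- have := Fmono _ _ It Iu tu; rewrite half => FF; exfalso.
  by move: H; rewrite ltr_norml; clear -pt pu FF; lra.
- have := Fmono _ _ Iu It ut; rewrite half => FF; exfalso.
  by move: H; rewrite ltr_norml; clear -pt pu FF; lra.
Qed.

End Kraft.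

(** * Ball codes *)

Section Codes.
Context {R : realType} {n : nat}.
Implicit Types (phi : ball_code R n) (x : 'rV[R]_n) (r : nat).

Lemma K_le phi x r p : code_dom phi p -> code_ball phi p x ->
  (diam (code_ball phi p) <= (2 ^- r)%:E)%E -> (K phi x r <= (size p)%:R%:E)%E.
Proof. by move=> Dp px dp; apply: ereal_inf_lbound; exists p. Qed.

Lemma K_lt phi x r (a : \bar R) : (K phi x r < a)%E ->
  exists p, [/\ code_dom phi p, code_ball phi p x,
    (diam (code_ball phi p) <= (2 ^- r)%:E)%E & ((size p)%:R%:E < a)%E].
Proof. by move=> /ereal_inf_lt[_ [p [Dp px dp] <-] pa]; exists p. Qed.

Lemma K_ge0 phi x r : (0 <= K phi x r)%E.
Proof. by apply: le_ereal_inf_tmp => _ [p _ <-]; rewrite lee_fin. Qed.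

Lemma code_of_lengths (T : countType) (I : set T) (l : T -> nat) (M : R)
    (B : T -> set 'rV[R]_n) :
  (forall t, I t -> is_eball (B t)) ->
  (\esum_(t in I) (2 ^- l t)%:E <= M%:E)%E ->
  exists phi (C : nat), forall t x r, I t -> B t x ->
    (diam (B t) <= (2 ^- r)%:E)%E -> (K phi x r <= (l t + C)%:R%:E)%E.
Proof.
move=> ballB /kraft_converse[w [C [pf wl]]].
(* Taking the union over all indices with word p avoids inverting [w]; on code words exactly one
   index contributes. *)
pose b p : set 'rV[R]_n := [set x | exists t, [/\ I t, w t = p & B t x]].
have bw t : I t -> b (w t) = B t.
  move=> It; apply/seteqP; split=> [x [u [Iu ut Bu]]|x Bx]; last by exists t.
  by rewrite (pf t u) ?ut ?prefix_refl.
have pfw : prefix_free (w @` I).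
  by move=> _ _ [t It <-] [u Iu <-] /(pf _ _ It Iu) ->.
have bb p : (w @` I) p -> is_eball (b p).
  by move=> [t It <-]; rewrite bw //; exact: ballB.
exists (BallCode pfw bb), C => t x r It tx dt; rewrite -wl.
by apply: K_le => /=; rewrite ?bw //; exists t.
Qed.

Let tag k p := nseq k true ++ false :: p.

Let prefix_tag k j p q : prefix (tag k p) (tag j q) = (k == j) && prefix p q.
Proof. by elim: k j => [|k IH] [|j]//=; rewrite IH. Qed.

Let tag_inj k j p q : tag k p = tag j q -> k = j /\ p = q.
Proof. by elim: k j => [|k IH] [|j] //= [] // /IH[-> ->]. Qed.

(** Tags with different k are never prefixes of one another, so a prefix relation between tagged
    words reduces to one inside a single [phi k]. *)
Lemma code_merge (phi : nat -> ball_code R n) :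
  exists psi, forall k x r, (K psi x r <= K (phi k) x r + k.+1%:R%:E)%E.
Proof.
pose D := [set tag kp.1 kp.2 | kp in [set kp | code_dom (phi kp.1) kp.2]].
pose b p : set 'rV[R]_n :=
  [set x | exists k q, tag k q = p /\ code_ball (phi k) q x].
have bE k q : b (tag k q) = code_ball (phi k) q.
  apply/seteqP; split=> [x [j [p [e jx]]]|x kx]; last by exists k, q.
  by case/tag_inj: e jx => -> ->.
have pf : prefix_free D.
  move=> _ _ [[k p] /= kp <-] [[j q] /= jq <-].
  rewrite prefix_tag => /andP[/eqP kj pq]; subst j.
  by rewrite (code_prefix_free kp jq pq).
have bb p : D p -> is_eball (b p).
  by move=> [[k q] /= kq <-]; rewrite bE; exact: code_is_ball.
exists (BallCode pf bb) => k x r; rewrite -leeBlDr //.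
apply: le_ereal_inf_tmp => _ [p [Dp px dp] <-].
rewrite leeBlDr // -EFinD -natrD; have -> : (size p + k.+1 = size (tag k p))%N.
  by rewrite size_cat size_nseq /= addnS addnS addnC.
by apply: K_le; rewrite /= ?bE //; exists (k, p).
Qed.

End Codes.

(** * Limits *)

Section Limits.
Context {R : realType}.
Implicit Types (u : nat -> \bar R) (f : R -> \bar R) (a : \bar R).
Local Open Scope ereal_scope.

Lemma limn_einf_lt u a m : limn_einf u < a -> exists2 r, (m <= r)%N & u r < a.
Proof.
move=> ua; have /ereal_inf_lt[_ [r mr <-] ra] : einfs u m < a.
  apply: le_lt_trans ua; rewrite limn_einf_lim (cvg_lim _ (@cvg_einfs_sup _ u)) //.
  by apply: ereal_sup_ubound; exists m.
by exists r.
Qed.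

Lemma limn_einf_le u a :
  (forall m, exists2 r, (m <= r)%N & u r <= a) -> limn_einf u <= a.
Proof.
move=> H; rewrite limn_einf_lim; apply: lime_le; first exact: is_cvg_einfs.
apply: nearW => m; have [r mr ra] := H m; apply: le_trans ra.
by apply: ereal_inf_lbound; exists r.
Qed.

Lemma limn_esup_lt u a :
  limn_esup u < a -> exists m, forall r, (m <= r)%N -> u r < a.
Proof.
rewrite limn_esup_lim (cvg_lim _ (@cvg_esups_inf _ u)) //.
move=> /ereal_inf_lt[_ [m _ <-] ma]; exists m => r mr.
by apply: le_lt_trans ma; apply: ereal_sup_ubound; exists r.
Qed.

Lemma limn_esup_le u a m :
  (forall r, (m <= r)%N -> u r <= a) -> limn_esup u <= a.
Proof.
move=> H; rewrite limn_esup_lim (cvg_lim _ (@cvg_esups_inf _ u)) //.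
apply: le_trans (_ : esups u m <= _); first by apply: ereal_inf_lbound; exists m.
by apply: ge_ereal_sup => _ [r mr <-]; exact: H.
Qed.

(** This and the next lemma replace the limits as delta tends to 0 by a supremum for Hausdorff
    measures and by an infimum for packing premeasures. *)
Lemma nonincreasing_lim_right0 f : {homo f : x y / (x <= y)%R >-> y <= x} ->
  lim (f x @[x --> 0%R^'+]) = ereal_sup (f @` [set x | (0 < x)%R]).
Proof.
move=> fh; have := @nonincreasing_at_right_cvge R f 0%R +oo%O isT.
move/(_ (in2W fh))/cvg_lim => -> //; congr (ereal_sup (f @` _)).
by apply/seteqP; split => x /=; rewrite in_itv /= andbT.
Qed.

Lemma nondecreasing_lim_right0 f : {homo f : x y / (x <= y)%R >-> x <= y} ->
  lim (f x @[x --> 0%R^'+]) = ereal_inf (f @` [set x | (0 < x)%R]).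
Proof.
move=> fh; have := @nondecreasing_at_right_cvge R f 0%R +oo%O isT.
move/(_ (in2W fh))/cvg_lim => -> //; congr (ereal_inf (f @` _)).
by apply/seteqP; split => x /=; rewrite in_itv /= andbT.
Qed.

End Limits.

(** * Euclidean balls *)

Section Euclid.
Context {R : realType} {n : nat}.
Implicit Types (x y z c : 'rV[R]_n) (U : set 'rV[R]_n).

Lemma edist_ge0 x y : 0 <= edist x y.
Proof. exact: sqrtr_ge0. Qed.

Lemma edistC x y : edist x y = edist y x.
Proof. by congr Num.sqrt; apply: eq_bigr => i _; rewrite -sqrrN opprB. Qed.

Lemma cauchy_schwarz (a b : 'I_n -> R) : \sum_i a i * b i <=
  Num.sqrt (\sum_i a i ^+ 2) * Num.sqrt (\sum_i b i ^+ 2).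
Proof.
have sq0 (f : 'I_n -> R) : 0 <= \sum_i f i ^+ 2.
  by apply: sumr_ge0 => i _; exact: sqr_ge0.
set A := Num.sqrt _; set B := Num.sqrt _.
have [A0 B0] : 0 <= A /\ 0 <= B by split; exact: sqrtr_ge0.
have A2 : A ^+ 2 = \sum_i a i ^+ 2 by rewrite sqr_sqrtr.
have B2 : B ^+ 2 = \sum_i b i ^+ 2 by rewrite sqr_sqrtr.
have vanish (f : 'I_n -> R) : \sum_i f i ^+ 2 = 0 -> forall i, f i = 0.
  move=> /eqP; rewrite psumr_eq0; last by move=> i _; exact: sqr_ge0.
  by move=> /allP H i; apply/eqP; rewrite -sqrf_eq0; exact: H (mem_index_enum i).
have [A00|Apos] := eqVneq A 0.
  rewrite A00 mul0r big1 // => i _; rewrite (vanish a) ?mul0r // -A2 A00.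
  by rewrite expr0n.
have [B00|Bpos] := eqVneq B 0.
  rewrite B00 mulr0 big1 // => i _; rewrite (vanish b) ?mulr0 // -B2 B00.
  by rewrite expr0n.
have AB : 0 < A * B by rewrite mulr_gt0 // lt_neqAle eq_sym ?Apos ?Bpos.
(* After multiplication by 2AB, the claim is the sum over i of (B a_i - A b_i)^2 >= 0. *)
rewrite -(ler_pM2l AB) -(ler_pM2l (ltr0Sn _ 1)) mulr_sumr mulr_sumr.
have -> : 2 * (A * B * (A * B)) = \sum_i (B ^+ 2 * a i ^+ 2 + A ^+ 2 * b i ^+ 2).
  by rewrite big_split /= -!mulr_sumr -A2 -B2; ring.
apply: ler_sum => i _; rewrite -subr_ge0.
by apply: le_trans (sqr_ge0 (B * a i - A * b i)) _; rewrite le_eqVlt; apply/orP; left;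
  apply/eqP; ring.
Qed.

Lemma edist_triangle x y z : edist x z <= edist x y + edist y z.
Proof.
pose a i := x ord0 i - y ord0 i; pose b i := y ord0 i - z ord0 i.
have sq0 (f : 'I_n -> R) : 0 <= \sum_i f i ^+ 2.
  by apply: sumr_ge0 => i _; exact: sqr_ge0.
rewrite -[leRHS]ger0_norm ?addr_ge0 ?edist_ge0 // -sqrtr_sqr.
rewrite /edist ler_sqrt ?sqr_ge0 // sqrrD !sqr_sqrtr //.
have -> : \sum_i (x ord0 i - z ord0 i) ^+ 2 =
    \sum_i a i ^+ 2 + (\sum_i a i * b i) *+ 2 + \sum_i b i ^+ 2.
  rewrite -sumrMnl -!big_split /=; apply: eq_bigr => i _.
  by rewrite -sqrrD /a /b; congr (_ ^+ 2); rewrite addrA subrK.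
by rewrite lerD2r lerD2l lerMn2r /=; exact: cauchy_schwarz.
Qed.

Lemma edistxx x : edist x x = 0.
Proof. by rewrite /edist big1 ?sqrtr0 // => i _; rewrite subrr expr0n. Qed.

Lemma eball_center c (r : R) : 0 <= r -> eball c r c.
Proof. by rewrite /eball /= edistxx. Qed.

Lemma edist_le_diam U x y : U x -> U y -> ((edist x y)%:E <= diam U)%E.
Proof. by move=> Ux Uy; apply: ereal_sup_ubound; exists (x, y). Qed.

Lemma diam_le U (d : R) :
  (forall x y, U x -> U y -> edist x y <= d) -> (diam U <= d%:E)%E.
Proof. by move=> H; apply: ge_ereal_sup => _ [[x y] [/= Ux Uy] <-]; exact: H. Qed.

Lemma diam_eball c (r : R) : (0 < n)%N -> 0 <= r ->
  diam (eball c r) = (2 * r)%:E.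
Proof.
move=> n0 r0; apply/eqP; rewrite eq_le; apply/andP; split.
  apply: diam_le => x y; rewrite /eball /= => cx cy.
  apply: le_trans (edist_triangle x c y) _; rewrite edistC mulr_natl.
  by rewrite mulr2n lerD.
(* The points c + r e_0 and c - r e_0 on a coordinate axis, available since n > 0, realize the
   diameter. *)
pose e (t : R) : 'rV[R]_n := c + t *: delta_mx ord0 (Ordinal n0).
have ed t u : edist (e t) (e u) = `|t - u|.
  rewrite /edist -sqrtr_sqr (bigD1 (Ordinal n0)) //= !mxE !eqxx /=.
  rewrite big1 ?addr0 => [|i i0]; last first.
    by rewrite !mxE (negPf i0) !mulr0 subrr expr0n.
  by congr Num.sqrt; congr (_ ^+ 2); ring.
have e0 : c = e 0 by rewrite /e scale0r addr0.
have -> : 2 * r = edist (e r) (e (- r)).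
  by rewrite ed opprK ger0_norm ?addr_ge0 // mulr_natl mulr2n.
by apply: edist_le_diam; rewrite /eball /= {1}e0 ed sub0r ?opprK ?normrN ger0_norm.
Qed.

Lemma eball_is_eball c (r : R) : 0 < r -> is_eball (eball c r).
Proof. by move=> r0; exists c, r. Qed.

Lemma eball_cover U c (r : R) : U c -> (diam U <= r%:E)%E -> U `<=` eball c r.
Proof.
move=> Uc dU x Ux; rewrite /eball /= -lee_fin.
by apply: le_trans dU; exact: edist_le_diam.
Qed.

End Euclid.

(** * Linear bounds on K(x;r) and the limits of K(x;r)/r *)

Section LimitComplexity.
Context {R : realType} {n : nat}.
Implicit Types (phi : ball_code R n) (x : 'rV[R]_n) (s : R).
Local Open Scope ereal_scope.

Lemma exists_ler_nat (e C : R) : (0 < e)%R ->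
  exists m, forall r, (m <= r)%N -> (0 < r)%N /\ (C <= e * r%:R)%R.
Proof.
move=> e0; exists (Num.truncn (C / e)).+1 => r mr; split; first exact: leq_trans mr.
rewrite mulrC -ler_pdivrMr //; apply: (le_trans (ltW (truncnS_gt _))).
by rewrite ler_nat.
Qed.

Let K_ratio_le phi x r s (e C : R) : (0 < r)%N -> (C <= e * r%:R)%R ->
  K phi x r <= (s * r%:R + C)%:E -> K phi x r / r%:R%:E <= (s + e)%:E.
Proof.
move=> r0 Cr Kr; have r0' : (0 < r%:R :> R)%R by rewrite ltr0n.
rewrite inver gt_eqF // lee_pdivrMr // (le_trans Kr) // -EFinM lee_fin mulrDl lerD2l //.
Qed.

(** Half of the tolerance goes to the slope, the other half absorbs C for large r; hence C must be
    fixed before m. *)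
Lemma K_liminf_le phi x s :
  (forall e, (0 < e)%R -> exists C : R, forall m, exists2 r, (m <= r)%N &
    K phi x r <= ((s + e) * r%:R + C)%:E) ->
  K_liminf phi x <= s%:E.
Proof.
move=> H; apply/lee_addgt0Pr => e e0.
have e2 : (0 < e / 2)%R by rewrite divr_gt0.
have [C HC] := H _ e2; have [m0 Hm] := exists_ler_nat C e2.
apply: limn_einf_le => m; have [r mr Kr] := HC (maxn m m0).
move: mr; rewrite geq_max => /andP[mr /Hm[r0 Cr]].
exists r => //; rewrite -EFinD [e in leRHS]splitr addrA.
exact: K_ratio_le Kr.
Qed.

Lemma K_limsup_le phi x s :
  (forall e, (0 < e)%R -> exists (C : R) m, forall r, (m <= r)%N ->
    K phi x r <= ((s + e) * r%:R + C)%:E) ->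
  K_limsup phi x <= s%:E.
Proof.
move=> H; apply/lee_addgt0Pr => e e0.
have e2 : (0 < e / 2)%R by rewrite divr_gt0.
have [C [m HC]] := H _ e2; have [m0 Hm] := exists_ler_nat C e2.
apply: (@limn_esup_le _ _ _ (maxn m m0)) => r.
rewrite geq_max => /andP[/HC Kr /Hm[r0 Cr]].
rewrite -EFinD [e in leRHS]splitr addrA; exact: K_ratio_le Kr.
Qed.

Lemma K_liminf_ge0 phi x : 0 <= K_liminf phi x.
Proof.
rewrite leNgt; apply/negP => /limn_einf_lt - /(_ 1%N)[r r1].
apply/negP; by rewrite -leNgt mule_ge0 ?K_ge0 // inve_ge0 lee_fin.
Qed.

Lemma K_liminf_lt phi x s m : K_liminf phi x < s%:E ->
  exists2 r, (m <= r)%N & K phi x r < (s * r%:R)%:E.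
Proof.
(* Asking for r > m ensures r > 0, so that the division by r can be undone. *)
move=> /limn_einf_lt - /(_ m.+1)[r mr Kr]; exists r; first exact: ltnW.
have r0 : (0 < r%:R :> R)%R by rewrite ltr0n; exact: leq_ltn_trans mr.
by move: Kr; rewrite inver gt_eqF // lte_pdivrMr.
Qed.

Lemma K_limsup_lt phi x s : K_limsup phi x < s%:E ->
  exists m, forall r, (m <= r)%N -> K phi x r < (s * r%:R)%:E.
Proof.
move=> /limn_esup_lt[m Hm]; exists m.+1 => r mr.
have r0 : (0 < r%:R :> R)%R by rewrite ltr0n; exact: leq_ltn_trans mr.
by have := Hm _ (ltnW mr); rewrite inver gt_eqF // lte_pdivrMr.
Qed.

End LimitComplexity.

(** * Powers of two *)

Section Powers.
Context {R : realType}.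
Implicit Types (s t e q x : R).

Lemma powR2V r : 2 ^- r = 2 `^ (- r%:R) :> R.
Proof. by rewrite powRN powR_mulrn. Qed.

Lemma powR2D x y : 2 `^ (x + y) = 2 `^ x * 2 `^ y :> R.
Proof. by rewrite powRD // pnatr_eq0 implybT. Qed.

Lemma powR2_gt0 x : 0 < 2 `^ x :> R.
Proof. exact: powR_gt0. Qed.

Lemma powR2_exp x r : 2 `^ (x * r%:R) = (2 `^ x) ^+ r :> R.
Proof. by rewrite powRrM powR_mulrn ?powR_ge0. Qed.

Lemma powR2N_lt1 x : 0 < x -> 2 `^ (- x) < 1 :> R.
Proof.
move=> x0; rewrite powRN invf_lt1 ?powR2_gt0 // -[ltLHS](congr1 (@^~ x) (@powR1 R)) /=.
by apply: gt0_ltr_powR => //; rewrite ?nnegrE ?ltr1n.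
Qed.

Lemma exists_powR2N_le x e : 0 < x -> 0 < e ->
  exists m, forall r, (m <= r)%N -> 2 `^ (- x * r%:R) <= e.
Proof.
move=> x0 e0; have q1 : `|2 `^ (- x)| < 1 :> R.
  by rewrite ger0_norm ?powR_ge0 // powR2N_lt1.
have /cvgrPdist_le /(_ _ e0)[m _ Hm] := cvg_expr q1.
exists m => r /Hm /=; rewrite sub0r normrN powR2_exp; apply: le_trans.
exact: ler_norm.
Qed.

Lemma exists_2V_le e : 0 < e -> exists m, forall r, (m <= r)%N -> 2 ^- r <= e.
Proof.
move=> /(exists_powR2N_le ltr01)[m Hm]; exists m => r /Hm.
by rewrite mulN1r powR2V.
Qed.

Lemma ltr_2V m r : (2 ^- m < 2 ^- r :> R) = (r < m)%N.
Proof. by rewrite ltf_pV2 ?posrE ?exprn_gt0 // ltr_eXn2l // ltr1n. Qed.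

(** The least r with 2^-(r+1) < x works: minimality gives the upper bound, or x <= 1 does if r =
    0. *)
Lemma dyadic_scale x : 0 < x -> x <= 1 ->
  exists r, 2 ^- r.+1 < x /\ x <= 2 ^- r.
Proof.
move=> x0 x1; have ex : exists r, 2 ^- r.+1 < x.
  have [m /(_ m.+1 (leqnSn _)) Hm] := exists_2V_le (divr_gt0 x0 (ltr0Sn _ 1)).
  by exists m; apply: le_lt_trans Hm _; lra.
case: (ex_minnP ex) => r rx minr; exists r; split=> //.
case: r rx minr => [|r] rx minr; first by rewrite expr0 invr1.
by rewrite leNgt; apply/negP => /minr; rewrite ltnn.
Qed.

Lemma exists_nat_round x : 0 <= x -> exists l : nat, x <= l%:R <= x + 1.
Proof.
move=> x0; exists (Num.truncn x).+1; rewrite ltW ?truncnS_gt //=.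
by rewrite -natr1 lerD2r truncn_le.
Qed.

(** Split rs = (s-t)r + tr: the first part is uniformly large because r >= m, the second exceeds p
    and leaves a weight to which Kraft's inequality applies. *)
Lemma powR_2V_le s t r m (p : nat) : t < s -> (m <= r)%N -> p%:R < t * r%:R ->
  (2 ^- r) `^ s <= 2 `^ (- (s - t) * m%:R) * 2 ^- p.
Proof.
move=> ts mr pr; rewrite !powR2V -powRrM -powR2D ler_powR ?ler1n //.
have : (s - t) * m%:R <= (s - t) * r%:R.
  by rewrite ler_wpM2l ?ler_nat // subr_ge0 ltW.
lra.
Qed.

End Powers.

(** * Estimates for unordered sums *)

Section Esum.
Context {R : realType}.
Implicit Types (c M q : R).
Local Open Scope ereal_scope.

Lemma esum_le_scale (T : choiceType) (I : set T) (a : T -> \bar R)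
    (b : T -> R) c M : (0 <= c)%R ->
  (forall i, I i -> a i <= (c * b i)%:E) ->
  \esum_(i in I) (b i)%:E <= M%:E -> \esum_(i in I) a i <= (c * M)%:E.
Proof.
move=> c0 ab bM; apply: ge_ereal_sup => _ [X [finX XI] <-].
have XM : \sum_(i \in X) (b i)%:E <= M%:E.
  by apply: le_trans bM; apply: ereal_sup_ubound; exists X.
apply: (@le_trans _ _ (\sum_(i \in X) (c * b i)%:E)).
  by apply: lee_fsum => // i /XI; exact: ab.
move: XM; rewrite !fsbig_finite //= !sumEFin !lee_fin -mulr_sumr => XM.
exact: ler_wpM2l.
Qed.

Lemma esum_const N c : (0 <= c)%R ->
  \esum_(i in [set i | (i < N)%N]) c%:E = (N%:R * c)%:E.
Proof.
move=> c0; rewrite esum_fset; first last.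
- by move=> i _; rewrite lee_fin.
- exact: finite_II.
by rewrite -(fsbig_ord _ N (fun=> c%:E)) sumEFin sumr_const card_ord mulr_natl.
Qed.

Lemma esum_geometric_le q : (0 <= q < 1)%R ->
  \esum_(k in [set: nat]) (q ^+ k)%:E <= ((1 - q)^-1)%:E.
Proof.
move=> /andP[q0 q1]; rewrite -nneseries_esumT; last first.
  by move=> k; rewrite lee_fin exprn_ge0.
apply: lime_le; first by apply: is_cvg_nneseries => k _ _; rewrite lee_fin exprn_ge0.
apply: nearW => k; rewrite sumEFin lee_fin big_mkord.
have q1' : (0 < 1 - q)%R by rewrite subr_gt0.
rewrite -[leRHS]mul1r ler_pdivlMr // mulrC.
by rewrite -opprB mulNr -subrX1 opprB gerBl exprn_ge0.
Qed.

End Esum.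

(** * From one code for each tolerance to a single code *)

Section Merge.
Context {R : realType} {n : nat}.
Implicit Types (phi : ball_code R n) (E : set 'rV[R]_n) (d : R).
Local Open Scope ereal_scope.

Let harmonic_le (e : R) : (0 < e)%R -> exists k : nat, (k.+1%:R^-1 <= e)%R.
Proof.
move=> e0; exists (Num.truncn e^-1); rewrite invf_ple ?posrE ?ltr0n //.
exact: ltW (truncnS_gt _).
Qed.

(** Merge the codes for the tolerances 1/(k+1). For a given e only one k is used, so its tag length
    k+1 joins the additive constant. *)
Lemma exists_code_liminf E d :
  (forall e, (0 < e)%R -> exists phi, forall x, E x -> exists C : R,
    forall m, exists2 r, (m <= r)%N & K phi x r <= ((d + e) * r%:R + C)%:E) ->
  exists psi, forall x, E x -> K_liminf psi x <= d%:E.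
Proof.
have inv0 k : (0 < k.+1%:R^-1 :> R)%R by rewrite invr_gt0 ltr0n.
move=> H; have /choice[phi phiP] k := H _ (inv0 k).
have [psi psiP] := code_merge phi; exists psi => x Ex; apply: K_liminf_le => e e0.
have [k ke] := harmonic_le e0; have [C HC] := phiP k x Ex.
exists (C + k.+1%:R)%R => m; have [r mr Kr] := HC m; exists r => //.
apply: le_trans (psiP k x r) _; rewrite addrA EFinD leeD2r //.
by apply: le_trans Kr _; rewrite lee_fin lerD2r ler_wpM2r ?lerD2l.
Qed.

Lemma exists_code_limsup E d :
  (forall e, (0 < e)%R -> exists phi, forall x, E x -> exists (C : R) m,
    forall r, (m <= r)%N -> K phi x r <= ((d + e) * r%:R + C)%:E) ->
  exists psi, forall x, E x -> K_limsup psi x <= d%:E.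
Proof.
have inv0 k : (0 < k.+1%:R^-1 :> R)%R by rewrite invr_gt0 ltr0n.
move=> H; have /choice[phi phiP] k := H _ (inv0 k).
have [psi psiP] := code_merge phi; exists psi => x Ex; apply: K_limsup_le => e e0.
have [k ke] := harmonic_le e0; have [C [m HC]] := phiP k x Ex.
exists (C + k.+1%:R)%R, m => r /HC Kr.
apply: le_trans (psiP k x r) _; rewrite addrA EFinD leeD2r //.
by apply: le_trans Kr _; rewrite lee_fin lerD2r ler_wpM2r ?lerD2l.
Qed.

End Merge.

(** * Hausdorff dimension *)

Section Hausdorff.
Context {R : realType} {n : nat} (n0 : (0 < n)%N).
Implicit Types (phi : ball_code R n) (E : set 'rV[R]_n) (s t d : R).
Local Open Scope ereal_scope.

Lemma hausdorff_delta_ge0 s d E : 0 <= hausdorff_delta s d E.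
Proof.
apply: le_ereal_inf_tmp => _ [I [U [_ ->]]].
by apply: esum_ge0 => i _; exact: poweR_ge0.
Qed.

Lemma hausdorff_measureE s E : hausdorff_measure s E =
  ereal_sup [set hausdorff_delta s d E | d in [set d | (0 < d)%R]].
Proof.
apply: nonincreasing_lim_right0 => d d' dd'; apply: le_ereal_inf_tmp.
move=> _ [I [U [[EU UI] ->]]]; apply: ereal_inf_lbound; exists I, U; split => //.
split => // i Ii; have [-> Ud] := UI i Ii; split => //.
by apply: le_trans Ud _; rewrite lee_fin.
Qed.

Lemma diam_code_gt0 phi p : code_dom phi p -> 0 < diam (code_ball phi p).
Proof.
move=> /code_is_ball[c [r [r0 ->]]]; rewrite diam_eball ?(ltW r0) //.
by rewrite lte_fin mulr_gt0.
Qed.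

Lemma hausdorff_measure_code phi E s t : (0 <= s)%R -> (t < s)%R ->
  (forall x, E x -> K_liminf phi x < t%:E) -> hausdorff_measure s E = 0.
Proof.
move=> s0 ts HE; apply/eqP; rewrite eq_le; apply/andP; split; last first.
  rewrite hausdorff_measureE; apply: le_trans (hausdorff_delta_ge0 s 1 E) _.
  by apply: ereal_sup_ubound; exists 1%R => //=.
rewrite hausdorff_measureE; apply: ge_ereal_sup => _ [d /= d0 <-].
apply/lee_addgt0Pr => e e0; rewrite add0e.
have st0 : (0 < s - t)%R by rewrite subr_gt0.
have [m1 Hm1] := exists_powR2N_le st0 e0.
have [m2 Hm2] := exists_2V_le d0.
(* [m1] makes the sum at most e, [m2] makes the diameters at most d. *)
pose m := maxn m1 m2.
pose G p r := [/\ code_dom phi p, (m <= r)%N,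
  diam (code_ball phi p) <= (2 ^- r)%:E & ((size p)%:R < t * r%:R)%R].
pose w i : seq bool := odflt [::] (unpickle i).
(* The first condition drops numbers that do not encode a word and makes [w] injective on [I]. The
   scale r is not part of the index, so a word that serves several scales is counted once. *)
pose I := [set i | pickle (w i) = i /\ exists r, G (w i) r].
have IE p r : G p r -> I (pickle p).
  by move=> Gp; split; rewrite /w pickleK //; exists r.
apply: le_trans (_ : \esum_(i in I) diam (code_ball phi (w i)) `^ s <= _).
  apply: ereal_inf_lbound; exists I, (fun i => code_ball phi (w i)); split => //.
  split=> [x Ex|i [_ [r [Dp mr dp _]]]]; last first.
    split; first exact: diam_code_gt0.
    by apply: le_trans dp _; rewrite lee_fin Hm2 // (leq_trans (leq_maxr _ _) mr).
  have [r mr /K_lt[p [Dp px dp pr]]] := K_liminf_lt m (HE x Ex).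
  exists (pickle p); last by rewrite /w pickleK.
  by apply: (IE p r); split => //; rewrite -lte_fin.
apply: le_trans (_ : (2 `^ (- (s - t) * m%:R) * 1)%:E <= _); last first.
  by rewrite lee_fin mulr1 Hm1 // leq_maxl.
apply: (@esum_le_scale _ _ _ _ (fun i => 2 ^- size (w i))%R).
- exact: powR_ge0.
- move=> i [_ [r [Dp mr dp pr]]].
  apply: le_trans (_ : (2 ^- r)%:E `^ s <= _).
    apply: gt0_ler_poweR => //; rewrite in_itv /= leey andbT;
      rewrite ?lee_fin ?invr_ge0 ?exprn_ge0 //.
    exact: ltW (diam_code_gt0 Dp).
  by rewrite poweR_EFin lee_fin powR_2V_le.
- apply: kraft => i j [wi [r [Dp _ _ _]]] [wj [r' [Dq _ _ _]]] pq.
  by rewrite -wi -wj (code_prefix_free Dp Dq pq).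
Qed.

Lemma hausdorff_code E s : (0 <= s)%R -> hausdorff_measure s E = 0 ->
  exists phi (C : R), forall x, E x -> forall m,
    exists2 r, (m <= r)%N & K phi x r <= (s * r%:R + C)%:E.
Proof.
move=> s0 HE.
(* The m-th cover has s-sum at most 2^-m, so all covers together have s-sum at most 2. The mesh
   2^-(m+1) leaves room for doubling diameters. *)
have /choice[IU HIU] m : exists IU : set nat * (nat -> set 'rV[R]_n),
    is_cover (2 ^- m.+1) E IU.1 IU.2 /\
    \esum_(i in IU.1) diam (IU.2 i) `^ s <= (2^-1 ^+ m)%:E.
  have m0 : (0 < 2 ^- m.+1 :> R)%R by rewrite invr_gt0 exprn_gt0.
  have : hausdorff_delta s (2 ^- m.+1) E < (2^-1 ^+ m)%:E.
    apply: (@le_lt_trans _ _ 0); last by rewrite lte_fin exprn_gt0 ?invr_gt0.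
    by rewrite -HE hausdorff_measureE; apply: ereal_sup_ubound; exists (2 ^- m.+1)%R.
  move=> /ereal_inf_lt[_ [I [U [IU ->]]] lt1].
  by exists (I, U); split => //; exact: ltW.
pose J := [set: nat] `*`` (fun m => (IU m).1); pose U p := (IU p.1).2 p.2.
(* q holds the center and radius of a ball around U, a scale r and a word length l. The radius is D
   = diam U, and 2^-(r+1) < 2D <= 2^-r. Thus D > 2^-(r+2), and rounding s(r+2) up to l gives 2^-l <=
   D^s. *)
pose good (p : nat * nat) (q : ('rV[R]_n * R) * (nat * nat)) :=
  [/\ U p `<=` eball q.1.1 q.1.2, (0 < q.1.2)%R, (2 * q.1.2 <= 2 ^- q.2.1)%R,
    (p.1 <= q.2.1)%N & (2 ^- q.2.2)%:E <= diam (U p) `^ s /\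
      (q.2.2%:R <= s * q.2.1%:R + (2 * s + 1))%R].
have /choice[f fP] p : exists q, J p -> good p q.
  case: (pselect (J p)) => [[_ Ip]|NJ]; last by exists ((0, 0), (0, 0))%R.
  have [[EU /(_ _ Ip)[dU0 dU]] _] := HIU p.1.
  rewrite -/(U p) in dU0 dU.
  have [c Uc] : U p !=set0.
    by apply/set0P/eqP => U0; move: dU0; rewrite U0 /diam setX0 image_set0 ereal_sup0.
  have [D DE] : exists D : R, diam (U p) = D%:E.
    exists (fine (diam (U p))); rewrite fineK // ge0_fin_numE ?(ltW dU0) //.
    exact: le_lt_trans dU (ltry _).
  rewrite DE lte_fin lee_fin in dU0 dU.
  have D2 : (2 * D <= 2 ^- p.1)%R.
    move: dU; rewrite exprS invfM; set z : R := (2 ^- p.1)%R; lra.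
  have [r [rD Dr]] : exists r, (2 ^- r.+1 < 2 * D)%R /\ (2 * D <= 2 ^- r)%R.
    apply: dyadic_scale; first by rewrite mulr_gt0.
    by apply: le_trans D2 _; rewrite invf_le1 ?exprn_gt0 // exprn_ege1 // ler1n.
  have [l /andP[l1 l2]] : exists l : nat, (s * r.+2%:R <= l%:R <= s * r.+2%:R + 1)%R.
    by apply: exists_nat_round; rewrite mulr_ge0.
  exists ((c, D), (r, l)) => _; split => //=.
  - by apply: eball_cover => //; rewrite DE.
  - by rewrite -ltnS -(@ltr_2V R); exact: lt_le_trans rD D2.
  split; last by apply: le_trans l2 _; rewrite -addn2 natrD; lra.
  rewrite DE poweR_EFin lee_fin powR2V; apply: (@le_trans _ _ ((2 ^- r.+2) `^ s)%R).
    by rewrite powR2V -powRrM ler_powR ?ler1n // mulNr mulrC lerN2.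
  apply: ge0_ler_powR; rewrite ?nnegrE ?invr_ge0 ?exprn_ge0 ?(ltW dU0) //.
  by move: rD; rewrite [(2 ^+ r.+2)%R]exprS invfM; set z : R := (2 ^- _)%R; lra.
pose B p := eball (f p).1.1 (f p).1.2.
have [||phi [C HC]] := @code_of_lengths R n (nat * nat)%type J (fun p => (f p).2.2)
    (1 * (1 - 2^-1)^-1)%R B.
- by move=> p /fP[_ r0 _ _ _]; exact: eball_is_eball.
- apply: le_trans (_ : \esum_(p in J) (diam (U p) `^ s) <= _).
    by apply: le_esum => p /fP[_ _ _ _ [+ _]].
  rewrite -(@esum_esum _ _ _ _ _ (fun m i => diam (U (m, i)) `^ s)); last first.
    by move=> *; exact: poweR_ge0.
  apply: (@esum_le_scale _ _ _ _ (fun m => 2^-1 ^+ m)%R) => //.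
    by move=> m _; rewrite mul1r; exact: (HIU m).2.
  by apply: esum_geometric_le; lra.
exists phi, (2 * s + 1 + C%:R)%R => x Ex m.
(* Every cover contains x in one of its sets, and the m-th one supplies a scale r >= m. *)
have [[EU _] _] := HIU m; have [i Ii Ux] := EU x Ex.
have Jmi : J (m, i) by [].
have [UB r0 dr mr [_ lr]] := fP _ Jmi.
exists (f (m, i)).2.1 => //.
apply: le_trans (HC (m, i) x _ Jmi (UB x Ux) _) _.
  by rewrite diam_eball ?(ltW r0) // lee_fin.
by rewrite lee_fin natrD addrA lerD2r.
Qed.

End Hausdorff.

(** * Packing dimension *)

Section Packing.
Context {R : realType} {n : nat} (n0 : (0 < n)%N).
Implicit Types (phi : ball_code R n) (E F : set 'rV[R]_n) (s t d e rho : R).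
Local Open Scope ereal_scope.

Lemma packing_delta_ge0 s d E : 0 <= packing_delta s d E.
Proof.
apply: ereal_sup_ubound; exists set0, (fun=> 0%R), (fun=> 0%R).
by rewrite esum_set0; split => //; split => // i j [].
Qed.

Lemma packing_premeasureE s E : packing_premeasure s E =
  ereal_inf [set packing_delta s d E | d in [set d | (0 < d)%R]].
Proof.
apply: nondecreasing_lim_right0 => d d' dd'; apply: ge_ereal_sup.
move=> _ [I [c [r [[Icr disj] ->]]]]; apply: ereal_sup_ubound; exists I, c, r.
split => //; split => // i /Icr[Ec r0 rd]; split => //; exact: le_trans rd dd'.
Qed.

Lemma packing_premeasure_ge0 s E : 0 <= packing_premeasure s E.
Proof.
rewrite packing_premeasureE; apply: le_ereal_inf_tmp => _ [d _ <-].
exact: packing_delta_ge0.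
Qed.

Lemma packing_measure_ge0 s E : 0 <= packing_measure s E.
Proof.
apply: le_ereal_inf_tmp => _ [F _ <-]; apply: nneseries_ge0 => j _ _.
exact: packing_premeasure_ge0.
Qed.

Lemma packing_premeasure_code phi E s t m : (0 <= s)%R -> (t < s)%R ->
  (forall x, E x -> forall r, (m <= r)%N -> K phi x r < (t * r%:R)%:E) ->
  packing_premeasure s E = 0.
Proof.
move=> s0 ts HE; apply/eqP; rewrite eq_le packing_premeasure_ge0 andbT.
rewrite packing_premeasureE; apply/lee_addgt0Pr => e e0; rewrite add0e.
have st0 : (0 < s - t)%R by rewrite subr_gt0.
have S0 : (0 < 4 `^ s :> R)%R by exact: powR_gt0.
(* The factor 4^s arises because a packing ball of radius at most 2 * 2^-r has diameter at most 4 *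
   2^-r. *)
have [m1 Hm1] := exists_powR2N_le st0 (divr_gt0 e0 S0).
pose m0 := maxn m m1.
apply: le_trans (_ : packing_delta s (2 ^- m0) E <= _).
  by apply: ereal_inf_lbound; exists (2 ^- m0)%R => //=; rewrite invr_gt0 exprn_gt0.
apply: ge_ereal_sup => _ [I [c [rho [[Ic disj] ->]]]].
pose good i (q : seq bool * nat) := [/\ (m0 <= q.2)%N, code_dom phi q.1,
  code_ball phi q.1 (c i), diam (code_ball phi q.1) <= (2 ^- q.2)%:E &
  ((size q.1)%:R < t * q.2%:R)%R /\ (2 ^- q.2 < rho i <= 2 * 2 ^- q.2)%R].
have /choice[f fP] i : exists q, I i -> good i q.
  case: (pselect (I i)) => [Ii|NI]; last by exists ([::], 0%N).
  have [Ei r0 rm] := Ic i Ii.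
  have [r [rl ru]] : exists r, (2 ^- r.+1 < rho i)%R /\ (rho i <= 2 ^- r)%R.
    apply: dyadic_scale => //; apply: le_trans rm _.
    by rewrite invf_le1 ?exprn_gt0 // exprn_ege1 // ler1n.
  have mr : (m0 <= r.+1)%N by rewrite ltnW // -(@ltr_2V R) (lt_le_trans rl).
  have [p [Dp px dp pr]] := K_lt (HE _ Ei r.+1 (leq_trans (leq_maxl _ _) mr)).
  (* The finer scale r+1 makes the code ball's diameter strictly smaller than the radius [rho i]. *)
  exists (p, r.+1) => _; split => //=; split; first by rewrite -lte_fin.
  by rewrite rl /= exprS invfM mulrA mulfV ?mul1r // pnatr_eq0.
apply: le_trans (_ : (4 `^ s * 2 `^ (- (s - t) * m0%:R) * 1)%:E <= _); last first.
  by rewrite lee_fin mulr1 mulrC -ler_pdivlMr // Hm1 // leq_maxr.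
apply: (@esum_le_scale _ _ _ _ (fun i => 2 ^- size (f i).1)%R).
- by rewrite mulr_ge0 // powR_ge0.
- move=> i Ii; have [mr _ _ _ [pr /andP[_ ru]]] := fP i Ii.
  have [_ r0 _] := Ic i Ii.
  rewrite diam_eball ?(ltW r0) // poweR_EFin lee_fin -mulrA.
  apply: (@le_trans _ _ ((4 * 2 ^- (f i).2) `^ s)%R).
    apply: ge0_ler_powR; rewrite ?nnegrE ?mulr_ge0 ?invr_ge0 ?exprn_ge0 ?(ltW r0) //.
    by move: ru; set z : R := (2 ^- _)%R; lra.
  rewrite powRM ?invr_ge0 ?exprn_ge0 // ler_pM2l //.
  exact: powR_2V_le.
(* Prefix-related words coincide, so one code ball contains both centers; then [c j] lies in the
   i-th packing ball as well as in its own, and disjointness forces i = j. *)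
- apply: kraft => i j Ii Ij pq.
  have [_ Di ci di [_ /andP[ri _]]] := fP i Ii.
  have [_ Dj cj dj [_ /andP[rj _]]] := fP j Ij.
  have e12 := code_prefix_free Di Dj pq.
  apply: disj => //; exists (c j); split; last first.
    by apply: eball_center; have [_ /ltW] := Ic j Ij.
  rewrite /eball /= ltW //; apply: le_lt_trans ri; rewrite -lee_fin.
  by apply: le_trans di; apply: edist_le_diam => //; rewrite e12.
Qed.

(** The threshold beyond which K(x;r) < tr depends on x. The countable decomposition in the packing
    measure sorts the points by threshold, which makes it uniform on each piece. *)
Lemma packing_measure_code phi E s t : (0 <= s)%R -> (t < s)%R ->
  (forall x, E x -> K_limsup phi x < t%:E) -> packing_measure s E = 0.
Proof.
move=> s0 ts HE; apply/eqP; rewrite eq_le packing_measure_ge0 andbT.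
pose F m := [set x | forall r, (m <= r)%N -> K phi x r < (t * r%:R)%:E].
apply: ereal_inf_lbound; exists F.
  by move=> x /HE/K_limsup_lt[m Hm]; exists m.
apply: eseries0 => m _ _; apply: (@packing_premeasure_code phi _ s t m) => // x.
Qed.

(* The balls of a maximal packing of radius rho cover F once their radius is
   doubled: a center outside of the doubled balls could be added. *)
Lemma finite_net F s d rho : (0 < rho <= d)%R -> packing_delta s d F <= 1 ->
  exists cs : seq 'rV[R]_n, ((size cs)%:R * (2 * rho) `^ s <= 1)%R /\
    forall x, F x -> exists2 i, (i < size cs)%N & eball (nth 0%R cs i) (2 * rho) x.
Proof.
move=> /andP[rho0 rhod] Fd.
pose packed (cs : seq 'rV[R]_n) := (forall i, (i < size cs)%N -> F (nth 0%R cs i)) /\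
  trivIset [set i | (i < size cs)%N] (fun i => eball (nth 0%R cs i) rho).
have S0 : (0 < (2 * rho) `^ s)%R by rewrite powR_gt0 // mulr_gt0.
have bound cs : packed cs -> ((size cs)%:R * (2 * rho) `^ s <= 1)%R.
  move=> [csF disj]; rewrite -lee_fin; apply: le_trans Fd.
  apply: ereal_sup_ubound; exists [set i | (i < size cs)%N], (nth 0%R cs), (fun=> rho).
  split; first by split => // i /csF.
  rewrite (eq_esum (b := fun=> ((2 * rho) `^ s)%:E)); last first.
    by move=> i _; rewrite diam_eball ?(ltW rho0) // poweR_EFin.
  by rewrite esum_const // ltW.
(* Each ball contributes (2 rho)^s to a sum of at most 1, which bounds the size of a packing; so one
   of maximal size exists. *)
pose P N := `[< exists2 cs, size cs = N & packed cs >].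
have P0 : exists N, P N by exists 0%N; apply/asboolP; exists [::] => //; split.
have PB N : P N -> (N <= Num.truncn ((2 * rho) `^ s)^-1)%N.
  move=> /asboolP[cs <- /bound csS]; rewrite truncn_ge_nat ?invr_ge0 ?powR_ge0 //.
  by rewrite -[leRHS]mul1r ler_pdivlMr.
case: (ex_maxnP P0 PB) => N /asboolP[cs csN csP] maxN.
exists cs; split; first exact: bound.
move=> x Fx; apply: contrapT => Nx.
suff : (N.+1 <= N)%N by rewrite ltnn.
apply: maxN; apply/asboolP; exists (x :: cs); first by rewrite /= csN.
have far i z : (i < size cs)%N -> (edist x z <= rho)%R ->
    (edist (nth 0%R cs i) z <= rho)%R -> False.
  move=> ics xz iz; apply: Nx; exists i => //; rewrite /eball /=.
  apply: le_trans (edist_triangle _ z _) _; rewrite (edistC z).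
  by rewrite mulr_natl mulr2n lerD.
have [csF disj] := csP; split=> [[|i] //= /csF //|[|i] [|j] //= ics jcs [z [zi zj]]].
- by case: (far _ _ jcs zi zj).
- by case: (far _ _ ics zj zi).
- by congr _.+1; apply: disj => //; exists z.
Qed.

(** The slack e makes the Kraft sum converge: with lengths about rs, each scale could contribute up
    to 2^s, whereas lengths about r(s+e) give a geometric series of ratio 2^-e. *)
Lemma packing_premeasure_lt1_code F s e : (0 <= s)%R -> (0 < e)%R ->
  packing_premeasure s F < 1 ->
  exists phi, forall x, F x -> exists (C : R) m, forall r, (m <= r)%N ->
    K phi x r <= ((s + e) * r%:R + C)%:E.
Proof.
move=> s0 e0; rewrite packing_premeasureE => /ereal_inf_lt[_ [d /= d0 <-] /ltW Fd].
have [m Hm] := exists_2V_le d0.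
(* Packing radius 2^-(r+2): the doubled balls have radius 2^-(r+1), hence diameter exactly 2^-r. *)
have /choice[cs csP] r : exists cs : seq 'rV[R]_n, (m <= r)%N ->
    ((size cs)%:R * (2 * 2 ^- r.+2) `^ s <= 1)%R /\
    forall x, F x ->
      exists2 i, (i < size cs)%N & eball (nth 0%R cs i) (2 * 2 ^- r.+2) x.
  have [mr|_] := boolP (m <= r)%N; last by exists [::].
  have [|cs csP] := @finite_net F s d (2 ^- r.+2) _ Fd; last by exists cs.
  by rewrite invr_gt0 exprn_gt0 //= Hm // !leqW.
have /choice[l lP] (r : nat) := exists_nat_round
  (mulr_ge0 (addr_ge0 s0 (ltW e0)) (ler0n R r)).
pose J := [set r | (m <= r)%N] `*`` (fun r => [set i | (i < size (cs r))%N]).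
pose B (p : nat * nat) := eball (nth 0%R (cs p.1) p.2) (2 * 2 ^- p.1.+2).
have half r : (2 * 2 ^- r.+2 = 2 ^- r.+1 :> R)%R.
  by rewrite exprS invfM mulrA mulfV ?mul1r // pnatr_eq0.
have pos r : (0 < 2 ^- r :> R)%R by rewrite invr_gt0 exprn_gt0.
pose q : R := (2 `^ (- e))%R.
have [||phi [C HC]] := @code_of_lengths R n (nat * nat)%type J (fun p => l p.1)
    (2 `^ s * (1 - q)^-1)%R B.
- by move=> p _; apply: eball_is_eball; rewrite half.
- rewrite -(@esum_esum _ _ _ _ _ (fun r i => (2 ^- l r)%:E)); last first.
    by move=> r i _ _; rewrite lee_fin ltW.
  rewrite esum_mkcond.
  apply: (@esum_le_scale _ _ _ _ (fun r => q ^+ r)%R); first exact: powR_ge0.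
    move=> r _; case: ifPn => [|_]; last first.
      by rewrite lee_fin mulr_ge0 ?exprn_ge0 ?powR_ge0.
    rewrite inE /= => /csP[csr _].
    rewrite esum_const ?(ltW (pos _)) // lee_fin.
    have /andP[lr _] := lP r.
    rewrite -powR2_exp -powR2D.
    apply: (@le_trans _ _ ((size (cs r))%:R * 2 `^ (- (s + e) * r%:R))%R).
      by rewrite ler_wpM2l // powR2V ler_powR ?ler1n // mulNr lerN2.
    move: csr; rewrite half powR2V -powRrM mulNr powRN ler_pdivrMr ?powR2_gt0 // mul1r.
    move=> csr; apply: le_trans (ler_wpM2r (powR_ge0 _ _) csr) _.
    rewrite -powR2D ler_powR ?ler1n // -natr1; lra.
  by apply: esum_geometric_le; rewrite powR_ge0 powR2N_lt1.
exists phi => x Fx; exists (1 + C%:R)%R, m => r mr.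
have [_ /(_ x Fx)[i ics Bx]] := csP r mr.
apply: le_trans (HC (r, i) x r _ Bx _) _ => //.
  by rewrite diam_eball ?mulr_ge0 ?(ltW (pos _)) //= half lee_fin exprS invfM mulrA
    mulfV ?mul1r // pnatr_eq0.
by rewrite lee_fin natrD addrA lerD2r; case/andP: (lP r).
Qed.

(** A decomposition with total premeasure below 1 has every piece below 1, so each piece has its own
    code; merging them costs a point of the j-th piece only the constant j+1. *)
Lemma packing_code E s e : (0 <= s)%R -> (0 < e)%R -> packing_measure s E = 0 ->
  exists phi, forall x, E x -> exists (C : R) m, forall r, (m <= r)%N ->
    K phi x r <= ((s + e) * r%:R + C)%:E.
Proof.
move=> s0 e0 E0; have : packing_measure s E < 1 by rewrite E0 lte_fin.
move=> /ereal_inf_lt[_ [F EF <-] sumF].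
have F1 j : packing_premeasure s (F j) < 1.
  apply: le_lt_trans sumF; rewrite nneseries_esumT; last first.
    by move=> k; exact: packing_premeasure_ge0.
  apply: esum_ge; exists [set j]; first by split => //; exact: finite_set1.
  by rewrite fsbig_set1.
have /choice[phi phiP] j := packing_premeasure_lt1_code s0 e0 (F1 j).
have [psi psiP] := code_merge phi; exists psi => x /EF[j _ /(phiP j)[C [m Hm]]].
exists (C + j.+1%:R)%R, m => r /Hm Kr.
by apply: le_trans (psiP j x r) _; rewrite addrA EFinD leeD2r.
Qed.

End Packing.

(** * The common scheme of both minimum statements *)

Section Minimum.
Context {R : realType} {n : nat}.
Local Open Scope ereal_scope.

Let empty_code : ball_code R n := @BallCode R n set0 (fun=> set0)
  (fun p q => @False_ind _) (fun p => @False_ind _).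

(** The second hypothesis on [kappa] yields the lower bound for every code, the third yields
    attainment. A point of E makes each supremum nonnegative, hence an admissible exponent if
    finite. *)
Lemma is_minimum_sup (kappa : ball_code R n -> 'rV[R]_n -> \bar R)
    (null : R -> Prop) (E : set 'rV[R]_n) : E !=set0 ->
  (forall phi x, 0 <= kappa phi x) ->
  (forall phi s t, (0 <= s)%R -> (t < s)%R ->
    (forall x, E x -> kappa phi x < t%:E) -> null s) ->
  (forall d,
    (forall e, (0 < e)%R -> exists s, [/\ (0 <= s)%R, (s < d + e)%R & null s]) ->
    exists phi, forall x, E x -> kappa phi x <= d%:E) ->
  is_minimum
    [set ereal_sup [set kappa phi x | x in E] | phi in [set: ball_code R n]]
    (ereal_inf [set s%:E | s in [set s : R | (0 <= s)%R /\ null s]]).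
Proof.
move=> [x0 Ex0] k0 knull kcode; set d := ereal_inf _.
have lb phi : d <= ereal_sup [set kappa phi x | x in E].
  set S := ereal_sup _.
  have kS x : E x -> kappa phi x <= S by move=> Ex; apply: ereal_sup_ubound; exists x.
  have S0 : 0 <= S by exact: le_trans (k0 phi x0) (kS _ Ex0).
  case: S kS S0 => [S kS S0|_ _|//]; last exact: leey.
  apply/lee_addgt0Pr => e e0; rewrite -EFinD.
  apply: ereal_inf_lbound; exists (S + e)%R => //; split.
    by rewrite addr_ge0 // ltW.
  (* The intermediate value S + e/2 turns the bound by S into a strict one while staying below S +
     e. *)
  apply: (knull phi _ (S + e / 2)%R).
  - by rewrite addr_ge0 // ltW.
  - by rewrite ltrD2l ltr_pdivrMr // ltr_pMr // ltr1n.
  - move=> x /kS; move=> /le_lt_trans -> //.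
    by rewrite lte_fin ltrDl divr_gt0.
split; last by move=> _ [phi _ <-].
suff [phi phiP] : exists phi, ereal_sup [set kappa phi x | x in E] <= d.
  by exists phi => //; apply/eqP; rewrite eq_le phiP lb.
have d0 : 0 <= d by apply: le_ereal_inf_tmp => _ [s [s0 _] <-].
(* If no exponent is admissible, the infimum is +oo and any code stays below it. *)
case dE : d d0 => [d'| |] // _; last by exists empty_code; exact: leey.
have [|phi phiP] := kcode d'.
  move=> e e0; have /ereal_inf_lt[_ [s [s0 sn] <-] sd] : d < (d' + e)%:E.
    by rewrite dE lte_fin ltrDl.
  by exists s; split => //; rewrite -lte_fin.
by exists phi; apply: ge_ereal_sup => _ [x Ex <-]; exact: phiP.
Qed.

End Minimum.

Theorem theorem1p1 (R : realType) (n : nat) (hn : (1 <= n)%N)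
    (E : set 'rV[R]_n) (hE : E !=set0) :
  is_minimum
    [set ereal_sup [set K_liminf phi x | x in E] | phi in [set: ball_code R n]]
    (hausdorff_dim E) /\
  is_minimum
    [set ereal_sup [set K_limsup phi x | x in E] | phi in [set: ball_code R n]]
    (packing_dim E).
Proof.
split; apply: is_minimum_sup => //.
- by move=> phi x; exact: K_liminf_ge0.
- by move=> phi s t s0 ts HE; exact: hausdorff_measure_code HE.
- move=> d H; apply: exists_code_liminf => e /H[s [s0 sd /(hausdorff_code hn s0)]].
  move=> [phi [C HC]]; exists phi => x Ex; exists C => m.
  have [r mr Kr] := HC x Ex m; exists r => //; apply: le_trans Kr _.
  by rewrite lee_fin lerD2r ler_wpM2r // ltW.
- by move=> phi x; apply: le_trans (K_liminf_ge0 phi x) (limn_einf_sup _).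
- by move=> phi s t s0 ts HE; exact: packing_measure_code HE.
- move=> d H; apply: exists_code_limsup => e e0.
  (* One half of e brings s close to d, the other is the slack of [packing_code]. *)
  have e2 : (0 < e / 2)%R by rewrite divr_gt0.
  have [s [s0 sd /(packing_code hn s0 e2)[phi phiP]]] := H _ e2.
  exists phi => x /phiP[C [m HC]]; exists C, m => r /HC Kr; apply: le_trans Kr _.
  by rewrite lee_fin lerD2r ler_wpM2r //; lra.
Qed.
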